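(* Let $\mathrm{OPT}$ be the optimal value (maximum expected total weight over all policies) of CDSRSE, let $p^*=\min\{P^o_{ir}: P^o_{ir}>0,\ i\in N,\ r\in M\}$, and let $\alpha_{\mathrm{pes}}$ be the maximum total weight of an independent set in the pessimistic interval graph $G_{\mathrm{pes}}$. Then $$\alpha_{\mathrm{pes}}\ \le\ \mathrm{OPT}\ \le\ \frac{1}{p^*}\,\alpha_{\mathrm{pes}}.$$
   Context: An instance consists of slots $M=[m]=\{1,\dots,m\}$, tasks $N=[n]$, weights $w\in\mathbb{R}_+^N$, and for each task $i\in N$ independent discrete distributions $D_i^s,D_i^e$ of its start time $s_i$ and end time $e_i$ in $M$, with supports $S_i,E_i\subseteq M$ satisfying $\max S_i\le\min E_i$; times of different tasks are independent. If scheduled, task $i$ occupies all slots of $[s_i,e_i]$. Put $a_i=\min S_i$, $d_i=\max E_i$, and $P^o_{ir}=\Pr[s_i\le r\le e_i]$. CDSRSE (conservative dynamic scheduling with random start and end times): the scheduler commits to tasks one at a time, adaptively. When an available task $i$ is committed (scheduled), it earns weight $w_i$, and $s_i,e_i$ are realized according to $D_i^s,D_i^e$. Every remaining task $j$ that possibly conflicts with $i$, i.e. for which some slot that $j$ occupies with positive probability lies in $[s_i,e_i]$, is deleted; all other remaining tasks are kept with unchanged distributions. The process ends when no task is available. The objective is to maximize the expected total weight of scheduled tasks. The pessimistic interval graph $G_{\mathrm{pes}}$ has vertex set $N$, with distinct $i,j$ adjacent iff the integer intervals $[a_i,d_i]$ and $[a_j,d_j]$ intersect; vertex $i$ has weight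 $w_i$. (By perfection of interval graphs, $\alpha_{\mathrm{pes}}$ equals the optimal value of $\min\{\sum_{r=1}^m\mu_r:\sum_{r=a_i}^{d_i}\mu_r\ge w_i\ \forall i\in N,\ \mu\ge 0\}$.) *)

(* Defs.v *)
From mathcomp Require Import all_boot all_order all_algebra.
Set Implicit Arguments.
Unset Strict Implicit.
Unset Printing Implicit Defensive.
Import Order.TTheory GRing.Theory Num.Theory.
Local Open Scope ring_scope.

(* Slots are 'I_m, i.e. {0, ..., m-1} instead of {1, ..., m}; only the order of
   the slots is used. *)

Record distr (R : realFieldType) (m : nat) := Distr {
  pmf :> 'I_m -> R;
  pmf_ge0 : forall x, 0 <= pmf x;
  pmf_sum1 : \sum_x pmf x = 1
}.

Definition supp (R : realFieldType) (m : nat) (D : distr R m) : {set 'I_m} :=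
  [set x | 0 < D x].

(* Used only on supports, which are nonempty; the default m of the minimum is
   larger than every slot. *)
Definition min_slot (m : nat) (A : {set 'I_m}) : nat :=
  \big[minn/m]_(x in A) (x : nat).
Definition max_slot (m : nat) (A : {set 'I_m}) : nat :=
  \max_(x in A) (x : nat).

Record instance (R : realFieldType) (m n : nat) := Instance {
  weight : 'I_n -> R;
  weight_ge0 : forall i, 0 <= weight i;
  startD : 'I_n -> distr R m;
  endD : 'I_n -> distr R m;
  start_le_end : forall i,
    (max_slot (supp (startD i)) <= min_slot (supp (endD i)))%N
}.

Section CDSRSE.
Variables (R : realFieldType) (m n : nat) (I : instance R m n).

Definition earliest (i : 'I_n) : nat := min_slot (supp (startD I i)).
Definition latest (i : 'I_n) : nat := max_slot (supp (endD I i)).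

(* The product form is the independence of s_i and e_i. *)
Definition time_pr (i : 'I_n) (s e : 'I_m) : R := startD I i s * endD I i e.

Definition occ_pr (i : 'I_n) (r : 'I_m) : R :=
  \sum_(s < m) \sum_(e < m | (s <= r <= e)%N) time_pr i s e.

(* The default value 1 bounds every probability from above, so it matters only
   when there is no task at all. *)
Definition pstar : R :=
  \big[Num.min/1]_(i < n) \big[Num.min/1]_(r < m | 0 < occ_pr i r) occ_pr i r.

Definition possible_conflict (s e : 'I_m) (j : 'I_n) : bool :=
  [exists r : 'I_m, (s <= r <= e)%N && (0 < occ_pr j r)].

Definition remaining (A : {set 'I_n}) (i : 'I_n) (s e : 'I_m) : {set 'I_n} :=
  [set j in A | (j != i) && ~~ possible_conflict s e j].

(* A (deterministic, history-dependent) policy as a decision tree: after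
   committing to a task, the continuation is chosen knowing the realized start
   and end times. *)
Inductive policy : Type :=
| Stop : policy
| Commit : 'I_n -> ('I_m -> 'I_m -> policy) -> policy.

(* Only available tasks are committed, and the process ends exactly when no
   task is available. *)
Fixpoint admissible (A : {set 'I_n}) (p : policy) : Prop :=
  match p with
  | Stop => A = set0
  | Commit i next =>
      i \in A /\ forall s e, admissible (remaining A i s e) (next s e)
  end.

(* Tasks are mutually independent, so whatever the history, the times of the
   task being committed are drawn from its own law. *)
Fixpoint expected_weight (p : policy) : R :=
  match p with
  | Stop => 0
  | Commit i next =>
      weight I i +
      \sum_(s < m) \sum_(e < m) time_pr i s e * expected_weight (next s e)
  end.

Definition is_optimal_value (v : R) : Prop :=
  (exists2 p, admissible setT p & expected_weight p = v) /\
  (forall p, admissible setT p -> expected_weight p <= v).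

Definition pes_adj : rel 'I_n := fun i j =>
  (i != j) && [exists r : 'I_m, (earliest i <= r <= latest i)%N
                                && (earliest j <= r <= latest j)%N].

Definition pes_independent (S : {set 'I_n}) : bool :=
  [forall i in S, forall j in S, ~~ pes_adj i j].

(* The empty set is independent, so 0 is one of the values maximized over. *)
Definition alpha_pes : R :=
  \big[Num.max/0]_(S : {set 'I_n} | pes_independent S) \sum_(i in S) weight I i.

End CDSRSE.

(* Main.v *)
Require Import Defs.
From mathcomp Require Import all_boot all_order all_algebra.
Set Implicit Arguments.
Unset Strict Implicit.
Unset Printing Implicit Defensive.
Import Order.TTheory GRing.Theory Num.Theory.
Local Open Scope ring_scope.

(** Lower bound: a policy that commits the tasks of an independent set [S] of
    the pessimistic graph first never deletes a task of [S].

    Upper bound: let [F t] be the largest weight of an independent set all of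
    whose tasks end before slot [t] surely.  The increments
    [mu r = F r.+1 - F r] form an optimal solution of the dual LP.  Task [i]
    occupies each slot of [[a_i, d_i]] with probability at least [pstar], so
    [pstar * w_i] is at most the expected [mu]-mass of the slots that [i] really
    occupies.  The slots occupied by the scheduled tasks are disjoint, hence
    [pstar] times the value of any policy is at most the total [mu]-mass, which
    is [alpha_pes]. *)

(** * Extreme slots of a nonempty set *)

Lemma min_slot_le (m : nat) (A : {set 'I_m}) (x : 'I_m) :
  x \in A -> (min_slot A <= x)%N.
Proof.
rewrite /min_slot -minEnat.
exact: (@bigmin_le_cond _ nat _ m x (mem A)).
Qed.

Lemma max_slot_ge (m : nat) (A : {set 'I_m}) (x : 'I_m) :
  x \in A -> (x <= max_slot A)%N.
Proof. exact: leq_bigmax_cond. Qed.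

Lemma min_slot_mem (m : nat) (A : {set 'I_m}) :
  A != set0 -> exists2 x, x \in A & x = min_slot A :> nat.
Proof.
case/set0Pn=> x0 x0A; rewrite /min_slot -minEnat.
have := @bigmin_eq_arg _ nat _ m x0 (mem A) (fun y : 'I_m => y : nat) x0A.
move=> ->; last by move=> x _; rewrite leEnat ltnW.
by case: Order.TotalTheory.arg_minP => // x xA _; exists x.
Qed.

Lemma max_slot_mem (m : nat) (A : {set 'I_m}) :
  A != set0 -> exists2 x, x \in A & x = max_slot A :> nat.
Proof.
case/set0Pn=> x0 x0A.
have := @eq_bigmax_cond _ (mem A) (fun y : 'I_m => y : nat).
case=> [|x xA eqx]; first by apply/card_gt0P; exists x0.
by exists x.
Qed.

Lemma supp_neq0 (R : realFieldType) (m : nat) (D : distr R m) :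
  supp D != set0.
Proof.
apply/eqP => D0; have /eqP := pmf_sum1 D.
rewrite big1 => [|x _]; first by rewrite eq_sym oner_eq0.
apply/eqP/negPn; rewrite neq_lt ltNge pmf_ge0 /=.
by have := in_set0 x; rewrite -D0 inE => ->.
Qed.

Section Instance.
Variables (R : realFieldType) (m n : nat) (I : instance R m n).
Implicit Types (A S : {set 'I_n}) (i j : 'I_n) (r s e : 'I_m).

Notation w := (weight I).

(** * The law of the start and end times of a task *)

Lemma time_pr_ge0 i s e : 0 <= time_pr I i s e.
Proof. by rewrite mulr_ge0 ?pmf_ge0. Qed.

Lemma time_pr_gt0 i s e :
  (0 < time_pr I i s e) = (s \in supp (startD I i)) && (e \in supp (endD I i)).
Proof.
rewrite !inE /time_pr; have [s0|s_gt0|s0] := ltgtP 0 (startD I i s).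
- by rewrite pmulr_rgt0.
- by have := pmf_ge0 (startD I i) s; rewrite leNgt s_gt0.
- by rewrite -s0 mul0r ltxx.
Qed.

Lemma sum_time_pr i : \sum_(s < m) \sum_(e < m) time_pr I i s e = 1.
Proof.
rewrite -[RHS](pmf_sum1 (startD I i)); apply: eq_bigr => s _.
by rewrite -mulr_sumr pmf_sum1 mulr1.
Qed.

Lemma expected_cst i (c : R) :
  \sum_(s < m) \sum_(e < m) time_pr I i s e * c = c.
Proof.
rewrite -[RHS]mul1r -(sum_time_pr i) mulr_suml.
by apply: eq_bigr => s _; rewrite mulr_suml.
Qed.

(** Outcomes of probability zero contribute nothing, so comparing on the supports suffices. *)
Lemma ler_expected i (f g : 'I_m -> 'I_m -> R) :
    (forall s e, 0 < time_pr I i s e -> f s e <= g s e) ->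
  \sum_(s < m) \sum_(e < m) time_pr I i s e * f s e <=
  \sum_(s < m) \sum_(e < m) time_pr I i s e * g s e.
Proof.
move=> le_fg; apply: ler_sum => s _; apply: ler_sum => e _.
have := time_pr_ge0 i s e; rewrite le_eqVlt => /predU1P[<-|t_gt0].
  by rewrite !mul0r.
by rewrite ler_pM2l // le_fg.
Qed.

Lemma occ_pr_ge0 i r : 0 <= occ_pr I i r.
Proof. by apply: sumr_ge0 => s _; apply: sumr_ge0 => e _; apply: time_pr_ge0. Qed.

Lemma occ_pr_pos i r s e :
  (s <= r <= e)%N -> 0 < time_pr I i s e -> 0 < occ_pr I i r.
Proof.
move=> sre t_gt0; rewrite /occ_pr (bigD1 s) //= (bigD1 e) //= -addrA.
rewrite ltr_pwDl // addr_ge0 // sumr_ge0 // => [e' _|s' _].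
  exact: time_pr_ge0.
by apply: sumr_ge0 => e' _; apply: time_pr_ge0.
Qed.

Lemma time_pr_pessimistic i s e :
  0 < time_pr I i s e -> (earliest I i <= s)%N && (e <= latest I i)%N.
Proof. by rewrite time_pr_gt0 => /andP[/min_slot_le -> /max_slot_ge ->]. Qed.

(* The hypothesis max S_i <= min E_i makes the possibly occupied slots of a task
   the whole interval [a_i, d_i]. *)
Lemma occ_pr_gt0 i r :
  (0 < occ_pr I i r) = (earliest I i <= r <= latest I i)%N.
Proof.
apply/idP/idP => [occ_gt0|/andP[le_ar le_rd]].
  have [/existsP[s /existsP[e /andP[/andP[sr re] t_gt0]]]|/existsPn no] :=
      boolP [exists s : 'I_m, exists e : 'I_m,
               (s <= r <= e)%N && (0 < time_pr I i s e)].
    have /andP[as_ ed] := time_pr_pessimistic t_gt0.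
    by rewrite (leq_trans as_ sr) (leq_trans re ed).
  move: occ_gt0; rewrite /occ_pr big1 ?ltxx // => s _; rewrite big1 // => e sre.
  have /existsPn/(_ e) := no s; rewrite sre /= -leNgt => t_le0.
  by apply/eqP; rewrite eq_le t_le0 time_pr_ge0.
have sle := start_le_end I i.
have [s1 s1S s1E] := min_slot_mem (supp_neq0 (startD I i)).
have [e1 e1S e1E] := max_slot_mem (supp_neq0 (endD I i)).
apply: (@occ_pr_pos i r s1 e1); first by rewrite s1E e1E le_ar le_rd.
by rewrite time_pr_gt0 s1S.
Qed.

(** Chain a_i <= max S_i <= min E_i <= d_i. *)
Lemma earliest_le_latest i : (earliest I i <= latest I i)%N.
Proof.
have [s sS sE] := min_slot_mem (supp_neq0 (startD I i)).
have [e eS eE] := max_slot_mem (supp_neq0 (endD I i)).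
rewrite /earliest -sE; apply: leq_trans (max_slot_ge sS) _.
by apply: leq_trans (start_le_end I i) _; rewrite (leq_trans (min_slot_le eS)) ?max_slot_ge.
Qed.

Lemma latest_lt i : (latest I i < m)%N.
Proof.
by have [e _ eE] := max_slot_mem (supp_neq0 (endD I i)); rewrite /latest -eE.
Qed.

Lemma pstar_gt0 : 0 < pstar I.
Proof.
by apply: lt_bigmin => [|i _]; rewrite ?ltr01 //; apply: lt_bigmin; rewrite ?ltr01.
Qed.

Lemma pstar_le i r : 0 < occ_pr I i r -> pstar I <= occ_pr I i r.
Proof.
move=> occ_gt0; apply: le_trans (bigmin_le _ i _) _.
exact: (bigmin_le_cond _ (occ_pr I i) occ_gt0).
Qed.

(** * Independent sets and the lower bound *)

Lemma pes_independentP S :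
  reflect {in S &, forall i j, ~~ pes_adj I i j} (pes_independent I S).
Proof.
apply: (iffP forall_inP) => [ind i j iS jS|ind i iS].
  by have /forall_inP := ind i iS; apply.
by apply/forall_inP => j jS; apply: ind.
Qed.

Lemma pes_independentS S S' :
  S' \subset S -> pes_independent I S -> pes_independent I S'.
Proof.
move=> /subsetP sub /pes_independentP ind; apply/pes_independentP => i j iS jS.
by apply: ind; apply: sub.
Qed.

Lemma ltn_card_remaining A i s e :
  i \in A -> (#|remaining I A i s e| < #|A|)%N.
Proof.
move=> iA; apply: proper_card; apply/properP; split.
  by apply/subsetP => j; rewrite inE => /andP[].
by exists i => //; rewrite inE eqxx andbF.
Qed.

(** Task [i] occupies only slots of [a_i, d_i], so a deleted [j] would share a slot with this
    interval and be adjacent to [i]. *)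
Lemma independent_remaining A S i s e :
    S \subset A -> pes_independent I S -> i \in S -> 0 < time_pr I i s e ->
  S :\ i \subset remaining I A i s e.
Proof.
move=> /subsetP sSA /pes_independentP ind iS t_gt0.
apply/subsetP => j /setD1P[ji jS]; rewrite inE sSA // ji /=.
apply/existsP => -[r /andP[/andP[sr re]]]; rewrite occ_pr_gt0 => jr.
have := ind i j iS jS; rewrite /pes_adj eq_sym ji /= => /existsPn/(_ r).
have /andP[as_ ed] := time_pr_pessimistic t_gt0.
by rewrite jr (leq_trans as_ sr) (leq_trans re ed).
Qed.

(** Induction on the number of available tasks, carrying along the part of [S] still available. *)
Lemma exists_policy_independent A S :
    S \subset A -> pes_independent I S ->
  exists2 p, admissible I A p & \sum_(i in S) w i <= expected_weight I p.
Proof.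
have [k] := ubnP #|A|; elim: k => // k IHk in A S *; rewrite ltnS => leAk.
move=> sSA ind; have [A0|[i0 i0A]] := set_0Vmem A.
  exists (@Stop m n) => //=; move: sSA; rewrite A0 subset0 => /eqP ->.
  by rewrite big_set0.
(* If [S] is exhausted, any available task is committed, since stopping early is not admissible. *)
have [i iA iS] : exists2 i, i \in A & S != set0 -> i \in S.
  have [->|[i iS]] := set_0Vmem S; first by exists i0 => //; rewrite eqxx.
  by exists i => //; apply: (subsetP sSA).
have next_ex (x : 'I_m * 'I_m) :
    exists p, admissible I (remaining I A i x.1 x.2) p /\
      \sum_(j in S :&: remaining I A i x.1 x.2) w j <= expected_weight I p.
  have [|||p adm le_p] :=
      IHk (remaining I A i x.1 x.2) (S :&: remaining I A i x.1 x.2).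
  - exact: leq_trans (ltn_card_remaining _ _ iA) leAk.
  - exact: subsetIr.
  - by apply: pes_independentS ind; apply: subsetIl.
  by exists p.
have [next nextP] := fin_all_exists next_ex.
exists (Commit i (fun s e => next (s, e))) => /=.
  by split=> // s e; have [] := nextP (s, e).
have [->|S_neq0] := eqVneq S set0.
  rewrite big_set0 addr_ge0 ?weight_ge0 // sumr_ge0 // => s _.
  rewrite sumr_ge0 // => e _; rewrite mulr_ge0 ?time_pr_ge0 //.
  by apply: le_trans (nextP (s, e)).2; apply: sumr_ge0 => j _; apply: weight_ge0.
rewrite (big_setD1 i) /= ?iS // lerD2l -{1}(expected_cst i (\sum_(j in _) _)).
apply: ler_expected => s e t_gt0.
(* An outcome of positive probability removes only [i] from [S]. *)
apply: le_trans (nextP (s, e)).2; rewrite (_ : S :&: _ = S :\ i) //=.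
apply/eqP; rewrite eqEsubset andbC subsetI subsetDl.
rewrite (independent_remaining sSA) ?iS //=.
by apply/subsetP => j; rewrite !inE => /and3P[-> _ /andP[->]].
Qed.

(** * Existence of an optimal policy *)

(** Backward induction: optimal continuations are fixed for all outcomes, then the best of the
    finitely many first tasks is taken. *)
Lemma exists_optimal_policy A :
  exists2 p, admissible I A p &
    forall q, admissible I A q -> expected_weight I q <= expected_weight I p.
Proof.
have [k] := ubnP #|A|; elim: k => // k IHk in A *; rewrite ltnS => leAk.
have [A0|[i0 i0A]] := set_0Vmem A.
  exists (@Stop m n) => // -[|i next] //= [].
  by rewrite A0 inE.
have next_ex (x : 'I_n * ('I_m * 'I_m)) : exists p, x.1 \in A ->
    admissible I (remaining I A x.1 x.2.1 x.2.2) p /\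
    forall q, admissible I (remaining I A x.1 x.2.1 x.2.2) q ->
      expected_weight I q <= expected_weight I p.
  have [iA|_] := boolP (x.1 \in A); last by exists (@Stop m n).
  have [|p adm opt] := IHk (remaining I A x.1 x.2.1 x.2.2); last by exists p.
  exact: leq_trans (ltn_card_remaining _ _ iA) leAk.
have [next nextP] := fin_all_exists next_ex.
pose best i := Commit i (fun s e => next (i, (s, e))).
have [i iA imax] := @Order.TotalTheory.arg_maxP _ R _ i0 (mem A)
  (expected_weight I \o best) i0A.
exists (best i); first by split=> // s e; have [] := nextP (i, (s, e)) iA.
case=> [/= A0|j q [jA adm]]; first by rewrite A0 inE in i0A.
apply: le_trans (imax j jA); rewrite /= lerD2l.
apply: ler_expected => s e _; have [_ opt] := nextP (j, (s, e)) jA.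
exact: opt (adm s e).
Qed.

(** * The dual solution *)

(** This is [F]: by the strict bound, [t = m] is no restriction and [t = 0] leaves only the empty
    set. *)
Definition alpha_before (t : nat) : R :=
  \big[Num.max/0]_(S : {set 'I_n} |
      pes_independent I S && [forall i in S, (latest I i < t)%N])
    \sum_(i in S) w i.

Lemma alpha_before_ge0 t : 0 <= alpha_before t.
Proof. exact: bigmax_ge_id. Qed.

Lemma alpha_before_geq t S :
    pes_independent I S -> {in S, forall i, (latest I i < t)%N} ->
  \sum_(i in S) w i <= alpha_before t.
Proof.
move=> ind lt_t; apply: (le_bigmax_cond _ (fun S => \sum_(i in S) w i)).
by rewrite ind; apply/forall_inP.
Qed.

Lemma alpha_before_leq t (c : R) :
    0 <= c ->
    (forall S, pes_independent I S -> {in S, forall i, (latest I i < t)%N} ->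
       \sum_(i in S) w i <= c) ->
  alpha_before t <= c.
Proof.
move=> c_ge0 le_c; apply: bigmax_le => // S /andP[ind /forall_inP].
exact: le_c.
Qed.

Lemma alpha_before_max : alpha_before m = alpha_pes I.
Proof.
apply: eq_bigl => S; rewrite [X in _ && X](_ : _ = true) ?andbT //.
by apply/forall_inP => i _; apply: latest_lt.
Qed.

Lemma le_alpha_before t t' :
  (t <= t')%N -> alpha_before t <= alpha_before t'.
Proof.
move=> le_t; apply: alpha_before_leq => [|S ind lt_t].
  exact: alpha_before_ge0.
by apply: alpha_before_geq => // i iS; apply: leq_trans (lt_t i iS) le_t.
Qed.

(** Recursion of weighted interval scheduling: adding [i] to an independent set ending before a_i
    keeps it independent. *)
Lemma alpha_before_add_task i :
  w i + alpha_before (earliest I i) <= alpha_before (latest I i).+1.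
Proof.
(* The singleton of [i] yields the nonnegative bound that [alpha_before_leq] requires. *)
have i_ge t : (latest I i < t)%N -> w i <= alpha_before t.
  move=> lt_t; rewrite -[w i](big_set1 +%R).
  apply: alpha_before_geq => [|j]; last by rewrite inE => /eqP->.
  by apply/pes_independentP => j k; rewrite !inE => /eqP-> /eqP->; rewrite /pes_adj eqxx.
rewrite -lerBrDl; apply: alpha_before_leq => [|S /pes_independentP ind lt_a].
  by rewrite subr_ge0 i_ge.
(* Slots from a_i on lie beyond every task of [S], so none is shared with [i]. *)
have no_adj j r : j \in S -> (earliest I i <= r)%N -> (latest I j < r)%N.
  by move=> /lt_a /leq_trans; apply.
have iNS : i \notin S.
  by apply/negP => /lt_a; rewrite ltnNge earliest_le_latest.
rewrite lerBrDl -big_setU1 //=; apply: alpha_before_geq.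
  apply/pes_independentP => j k; rewrite !inE.
  move=> /predU1P[->|jS] /predU1P[->|kS]; last exact: ind.
  - by rewrite /pes_adj eqxx.
  - rewrite negb_and; apply/orP; right; apply/existsPn => r.
    apply/negP => /andP[/andP[/(no_adj _ _ kS) + _] /andP[_]].
    by rewrite ltnNge => /negP.
  - rewrite negb_and; apply/orP; right; apply/existsPn => r.
    apply/negP => /andP[/andP[_ le_rd] /andP[/(no_adj _ _ jS)]].
    by rewrite ltnNge le_rd.
move=> j; rewrite !inE => /predU1P[->//|/lt_a lt_ja].
by rewrite ltnS; apply: leq_trans (ltnW lt_ja) (earliest_le_latest i).
Qed.

Definition dual_price (r : nat) : R := alpha_before r.+1 - alpha_before r.

Lemma dual_price_ge0 r : 0 <= dual_price r.
Proof. by rewrite subr_ge0 le_alpha_before. Qed.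

Lemma sum_dual_price_le : \sum_(r < m) dual_price r <= alpha_pes I.
Proof.
rewrite -(big_mkord xpredT dual_price) telescope_sumr // alpha_before_max.
by rewrite gerBl alpha_before_ge0.
Qed.

(** The sum telescopes to [F (d_i + 1) - F a_i], which the recursion bounds below by w_i. *)
Lemma dual_price_feasible i :
  w i <= \sum_(r < m | (earliest I i <= r <= latest I i)%N) dual_price r.
Proof.
have -> : \sum_(r < m | (earliest I i <= r <= latest I i)%N) dual_price r =
          \sum_(earliest I i <= r < (latest I i).+1) dual_price r.
  rewrite (big_nat_widen _ _ m) ?latest_lt // big_geq_mkord.
  by apply: eq_bigl => r; rewrite andbC ltnS.
rewrite telescope_sumr ?lerBrDr ?alpha_before_add_task //.
by rewrite leqW ?earliest_le_latest.
Qed.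

(** * Charging rewards to slots *)

(** The total price of these slots is the budget bounding [pstar] times the value attainable from
    [A]. *)
Definition possible_slots A : {set 'I_m} :=
  [set r | [exists j in A, 0 < occ_pr I j r]].

(** Deleting conflicting tasks makes the slots taken by [i] disjoint from those the remaining tasks
    may use, so the budget of [A] pays for both. *)
Lemma possible_slots_commit A i s e :
    i \in A -> 0 < time_pr I i s e ->
  \sum_(r < m | (s <= r <= e)%N) dual_price r +
    \sum_(r in possible_slots (remaining I A i s e)) dual_price r <=
  \sum_(r in possible_slots A) dual_price r.
Proof.
move=> iA t_gt0; rewrite [leRHS](bigID (fun r : 'I_m => (s <= r <= e)%N)) /=.
apply: lerD.
  rewrite [leRHS](eq_bigl (fun r : 'I_m => (s <= r <= e)%N)) // => r.
  rewrite andbC andb_idr // => sre; rewrite inE; apply/exists_inP; exists i => //.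
  exact: occ_pr_pos sre t_gt0.
rewrite [leRHS](bigID (mem (possible_slots (remaining I A i s e)))) /=.
rewrite ler_wpDr //; first by apply: sumr_ge0 => r _; apply: dual_price_ge0.
rewrite le_eqVlt; apply/predU1P; left; apply: eq_bigl => r.
rewrite andbC; apply/esym/andb_idr; rewrite !inE => /exists_inP[j].
rewrite inE => /and3P[jA _ /existsPn/(_ r)] + occ_gt0.
rewrite occ_gt0 andbT => ->; rewrite andbT.
by apply/exists_inP; exists j.
Qed.

(** Exchange of sums: the price of [r] is counted exactly when [i] occupies [r]. *)
Lemma expected_dual_price i :
  \sum_(s < m) \sum_(e < m) time_pr I i s e *
    (\sum_(r < m | (s <= r <= e)%N) dual_price r) =
  \sum_(r < m) occ_pr I i r * dual_price r.
Proof.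
transitivity (\sum_(s < m) \sum_(e < m) \sum_(r < m)
   (if (s <= r <= e)%N then time_pr I i s e * dual_price r else 0)).
  apply: eq_bigr => s _; apply: eq_bigr => e _.
  by rewrite mulr_sumr big_mkcond.
transitivity (\sum_(s < m) \sum_(r < m) \sum_(e < m)
   (if (s <= r <= e)%N then time_pr I i s e * dual_price r else 0)).
  by apply: eq_bigr => s _; rewrite exchange_big.
rewrite exchange_big; apply: eq_bigr => r _.
rewrite mulr_suml; apply: eq_bigr => s _.
by rewrite mulr_suml -big_mkcond.
Qed.

(** Dual feasibility bounds w_i by the prices on [a_i, d_i], where every occupation probability is
    at least [pstar]. *)
Lemma pstar_weight_le i :
  pstar I * w i <= \sum_(r < m) occ_pr I i r * dual_price r.
Proof.
apply: le_trans (ler_wpM2l (ltW pstar_gt0) (dual_price_feasible i)) _.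
rewrite mulr_sumr big_mkcond; apply: ler_sum => r _.
rewrite -occ_pr_gt0; case: ifP => [occ_gt0|_].
  by rewrite ler_wpM2r ?dual_price_ge0 ?pstar_le.
by rewrite mulr_ge0 ?occ_pr_ge0 ?dual_price_ge0.
Qed.

Lemma expected_weight_le_slots A (p : policy m n) :
    admissible I A p ->
  pstar I * expected_weight I p <= \sum_(r in possible_slots A) dual_price r.
Proof.
elim: p A => [|i next IH] A /=.
  by move=> _; rewrite mulr0 sumr_ge0 // => r _; apply: dual_price_ge0.
move=> [iA adm]; rewrite mulrDr.
apply: le_trans (lerD (pstar_weight_le i) (lexx _)) _.
rewrite -expected_dual_price -lerBrDl mulr_sumr.
(* Writing the budget as its own expectation allows a comparison outcome by outcome. *)
rewrite -(expected_cst i (\sum_(r in possible_slots A) _)).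
rewrite lerBrDl -big_split /=.
under eq_bigr => s _ do rewrite mulr_sumr -big_split /=.
under eq_bigr => s _ do under eq_bigr => e _ do rewrite mulrCA -mulrDr.
apply: ler_expected => s e t_gt0.
apply: le_trans (possible_slots_commit iA t_gt0).
by rewrite lerD2l; apply: IH.
Qed.

Lemma expected_weight_le (p : policy m n) :
  admissible I setT p -> expected_weight I p <= 1 / pstar I * alpha_pes I.
Proof.
move=> /expected_weight_le_slots le_p.
rewrite mul1r mulrC ler_pdivlMr ?pstar_gt0 // mulrC; apply: le_trans le_p _.
apply: le_trans _ sum_dual_price_le.
(* Slots that no task can occupy only add nonnegative prices. *)
rewrite [leRHS](bigID (mem (possible_slots setT))) /=.
by rewrite lerDl sumr_ge0 // => r _; apply: dual_price_ge0.
Qed.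

End Instance.

Theorem mainTheorem6 (R : realFieldType) (m n : nat) (I : instance R m n) :
  exists OPT : R,
    is_optimal_value I OPT /\
    alpha_pes I <= OPT <= 1 / pstar I * alpha_pes I.
Proof.
have [p adm opt] := exists_optimal_policy I setT.
exists (expected_weight I p); split; first by split=> //; exists p.
rewrite expected_weight_le // andbT.
have ge_S S : pes_independent I S -> \sum_(i in S) weight I i <= expected_weight I p.
  move=> /(exists_policy_independent (subsetT S))[q adm_q le_q].
  exact: le_trans le_q (opt q adm_q).
apply: bigmax_le => //.
(* The default 0 of the maximum is the weight of the empty set. *)
have := ge_S set0; rewrite big_set0; apply.
by apply/pes_independentP => i j; rewrite inE.
Qed.
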